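(* Let $\mathcal{G}$ be a forest, that is, a graph whose connected components are trees. Then the following conditions are equivalent: (i) $\mathcal{G}$ admits an adapted complex structure; (ii) $\mathcal{G}$ has an even number of connected components, and each connected component has at most one even vertex.
   Context: Graphs are finite and simple. A vertex is even (odd) if its degree is even (odd); an isolated vertex has degree $0$ and is even. For a graph $\mathcal{G}=(V,E)$ label $V=\{v_1,\dots,v_n\}$ and write $e_{i,j}$ ($i<j$) for the edge joining $v_i$ and $v_j$, if it exists. The Lie algebra $\mathfrak{n}_{\mathcal{G}}$ is the real vector space with basis $V\cup E$ and Lie bracket $[v_i,v_j]=e_{i,j}$ for $i<j$ if $v_i,v_j$ are adjacent, $[v_i,v_j]=0$ if they are not adjacent, and all elements of $E$ central. A complex structure on a real Lie algebra $\mathfrak{g}$ is a linear map $J:\mathfrak{g}\to\mathfrak{g}$ with $J^2=-\mathrm{Id}$ and $[x,y]+J([Jx,y]+[x,Jy])-[Jx,Jy]=0$ for all $x,y\in\mathfrak{g}$. The graph $\mathcal{G}$ admits an adapted complex structure if there is a complex structure $J$ on $\mathfrak{n}_{\mathcal{G}}$ such that for every $x\in V\cup E$ either $Jx\in V\cup E$ or $-Jx\in V\cup E$. *)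

(* Defs.v *)
From HB Require Import structures.
From mathcomp Require Import all_boot all_order all_algebra.
From mathcomp Require Import reals.

Set Implicit Arguments.
Unset Strict Implicit.
Unset Printing Implicit Defensive.

Import GRing.Theory.
Local Open Scope ring_scope.

Record sgraph (n : nat) := SGraph {
  adj :> rel 'I_n;
  adj_sym : symmetric adj;
  adj_irr : irreflexive adj
}.

Section Graph.
Variables (n : nat) (G : sgraph n).
Implicit Types (x y v : 'I_n) (C : {set 'I_n}).

Definition deg v : nat := #|[set u | G v u]|.

Definition even_vertex v : bool := ~~ odd (deg v).

Definition components : {set {set 'I_n}} :=
  equivalence_partition (connect G) [set: 'I_n].

Definition induced C : rel 'I_n := [rel x y | [&& x \in C, y \in C & G x y]].

(* The bound 2 < size c discards [::] and the back-and-forth closed walks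
   [:: x; y], which ucycle accepts. *)
Definition is_tree C : Prop :=
  [/\ C != set0,
      {in C &, forall x y, connect (induced C) x y}
    & ~ exists c : seq 'I_n, ucycle (induced C) c /\ (2 < size c)%N].

Definition is_forest : Prop := forall C, C \in components -> is_tree C.

Definition edge : Type :=
  {p : 'I_n * 'I_n | (p.1 < p.2)%N && G p.1 p.2}.

HB.instance Definition _ := Finite.on edge.

End Graph.

HB.mixin Record isLieAlgebra (R : pzRingType) L of GRing.Lmodule R L := {
  lie : L -> L -> L;
  lie_linearl : forall y, linear (lie^~ y);
  lie_linearr : forall x, linear (lie x);
  liexx : forall x, lie x x = 0;
  lie_jacobi : forall x y z,
    lie x (lie y z) + lie y (lie z x) + lie z (lie x y) = 0
}.

#[short(type="lieAlgType")]
HB.structure Definition LieAlgebra (R : pzRingType) :=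
  {L of GRing.Lmodule R L & isLieAlgebra R L}.

Notation "[lie x , y ]" := (lie x y)
  (at level 0, x at level 99, y at level 99, format "[lie  x ,  y ]")
  : ring_scope.

Definition complex_structure (R : realType) (L : lieAlgType R)
    (J : {linear L -> L}) : Prop :=
  (forall x, J (J x) = - x) /\
  (forall x y,
    [lie x, y] + J ([lie J x, y] + [lie x, J y]) - [lie J x, J y] = 0).

Section GraphLieAlgebra.
Variables (R : realType) (n : nat) (G : sgraph n).

Definition basis_index : Type := ('I_n + edge G)%type.

HB.instance Definition _ := Finite.on basis_index.

Definition graph_lie : Type := {ffun basis_index -> R^o}.

HB.instance Definition _ := GRing.Lmodule.on graph_lie.

Definition basis_vec (b : basis_index) : graph_lie :=
  [ffun c => (c == b)%:R].

(* e_{i,j} if i < j are adjacent, 0 otherwise. *)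
Definition edge_vec (i j : 'I_n) : graph_lie :=
  if insub (i, j) is Some a then basis_vec (inr a) else 0.

(* At most one of the two terms is nonzero. *)
Definition basis_bracket (b c : basis_index) : graph_lie :=
  match b, c with
  | inl i, inl j => edge_vec i j - edge_vec j i
  | _, _ => 0
  end.

Definition graph_bracket (x y : graph_lie) : graph_lie :=
  \sum_(b : basis_index) \sum_(c : basis_index)
    (x b * y c) *: basis_bracket b c.

Lemma graph_bracket_linearl (y : graph_lie) : linear (graph_bracket^~ y).
Proof.
move=> a x x'; rewrite /graph_bracket scaler_sumr -big_split /=.
apply: eq_bigr => b _; rewrite scaler_sumr -big_split /=.
by apply: eq_bigr => c _; rewrite !ffunE mulrDl scalerDl scalerA -mulrA.
Qed.

Lemma graph_bracket_linearr (x : graph_lie) : linear (graph_bracket x).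
Proof.
move=> a y y'; rewrite /graph_bracket scaler_sumr -big_split /=.
apply: eq_bigr => b _; rewrite scaler_sumr -big_split /=.
by apply: eq_bigr => c _; rewrite !ffunE mulrDr scalerDl scalerA mulrCA.
Qed.

Lemma basis_bracketN (b c : basis_index) :
  basis_bracket b c = - basis_bracket c b.
Proof. by case: b c => [i|a] [j|a'] /=; rewrite ?opprB ?oppr0. Qed.

Lemma graph_bracketxx (x : graph_lie) : graph_bracket x x = 0.
Proof.
have bN : graph_bracket x x = - graph_bracket x x.
  rewrite {1}/graph_bracket exchange_big /graph_bracket -sumrN /=.
  apply: eq_bigr => b _; rewrite -sumrN; apply: eq_bigr => c _.
  by rewrite mulrC basis_bracketN scalerN.
have /eqP : (2%:R : R) *: graph_bracket x x = 0.
  by rewrite scaler_nat mulr2n {2}bN subrr.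
by rewrite scaler_eq0 Num.Theory.pnatr_eq0 /= => /eqP.
Qed.

Lemma basis_bracket_vertex b c i : (basis_bracket b c : graph_lie) (inl i) = 0.
Proof.
have ev k l : edge_vec k l (inl i) = 0.
  by rewrite /edge_vec; case: insubP => [a _ _|_]; rewrite ffunE.
by case: b c => [k|a] [l|a'] /=; rewrite !ffunE // !ev subrr.
Qed.

Lemma graph_bracket_vertex x y i : graph_bracket x y (inl i) = 0.
Proof.
rewrite /graph_bracket sum_ffunE big1 // => b _; rewrite sum_ffunE big1 // => c _.
by rewrite ffunE basis_bracket_vertex scaler0.
Qed.

Lemma graph_bracket_central x y z : graph_bracket x (graph_bracket y z) = 0.
Proof.
rewrite {1}/graph_bracket big1 // => b _; rewrite big1 // => -[i|a] _.
  by rewrite graph_bracket_vertex mulr0 scale0r.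
by case: b => [j|a'] /=; rewrite scaler0.
Qed.

Lemma graph_bracket_jacobi x y z :
  graph_bracket x (graph_bracket y z) + graph_bracket y (graph_bracket z x)
  + graph_bracket z (graph_bracket x y) = 0.
Proof. by rewrite !graph_bracket_central !addr0. Qed.

HB.instance Definition _ := isLieAlgebra.Build R graph_lie
  graph_bracket_linearl graph_bracket_linearr graph_bracketxx
  graph_bracket_jacobi.

Lemma lie_basis (b c : basis_index) :
  [lie basis_vec b, basis_vec c] = basis_bracket b c.
Proof.
rewrite /lie /= /graph_bracket (bigD1 b) //= (bigD1 c) //= !ffunE !eqxx mulr1 scale1r.
rewrite [X in _ + X + _]big1 => [|d /negPf cd]; last by rewrite !ffunE cd mulr0 scale0r.
rewrite big1 ?addr0 // => d /negPf bd.
by rewrite big1 // => d' _; rewrite ffunE bd mul0r scale0r.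
Qed.

Lemma lie_edge (a : edge G) :
  [lie basis_vec (inl (val a).1), basis_vec (inl (val a).2)]
  = basis_vec (inr a).
Proof.
rewrite lie_basis /= /edge_vec -surjective_pairing valK insubF ?subr0 //=.
by case: a => -[i j] /= /andP[ij _]; rewrite ltnNge (ltnW ij).
Qed.

Lemma lie_nonadj (i j : 'I_n) :
  ~~ G i j -> [lie basis_vec (inl i), basis_vec (inl j)] = 0.
Proof.
move=> /negPf Gij; rewrite lie_basis /= /edge_vec.
by rewrite !insubF ?subrr //= ?(adj_sym G j) Gij andbF.
Qed.

End GraphLieAlgebra.

Definition admits_adapted_complex_structure
    (R : realType) (n : nat) (G : sgraph n) : Prop :=
  exists J : {linear graph_lie R G -> graph_lie R G},
    complex_structure J /\
    forall b : basis_index G, exists c : basis_index G,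
      J (basis_vec R b) = basis_vec R c \/ - J (basis_vec R b) = basis_vec R c.

(* Main.v *)
From HB Require Import structures.
Require Import Defs.
From mathcomp Require Import all_boot all_order all_algebra.
From mathcomp Require Import reals.

(* An adapted J is a signed fixed-point-free involution p of V + E. Let t v be
   the vertex p v, or v itself when p v is an edge. In a forest, integrability
   amounts to the condition that every edge other than those of the form {v, t
   v} lies in a unique "cherry": two edges {u, w}, {u, t w} with a common
   centre u and J-related leaves, on which J [u, w] = [u, J w]. In a forest
   every vertex v is a leaf of at most one cherry, and not of one if {v, t v}
   is an edge; so v is odd iff one of the two occurs. A simple path from an
   even vertex therefore runs from centres to leaves and cannot reach a second
   even vertex. Conversely, given (ii), root each tree at its even vertex if
   there is one, pair siblings, and pair the root of a tree without even
   vertex with one of its children. The number of components enters only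
   through the parity of |V| + |E| = 2 |V| - #components, which decides
   whether the remaining basis elements (even roots and edges {v, t v}) can be
   matched, arbitrarily, by J. *)

Set Implicit Arguments.
Unset Strict Implicit.
Unset Printing Implicit Defensive.

Import GRing.Theory.

(** * Fixed-point-free involutions on finite sets *)

Section FiniteMatchings.
Variables (T K : finType).
Implicit Types A : {set T}.

(** [f] exchanges the elements of [A] whose [enum_rank] it raises with those whose [enum_rank] it
    lowers. *)
Lemma involution_card_even A (f : T -> T) :
    {in A, forall x, [/\ f x \in A, f x != x & f (f x) = x]} ->
  ~~ odd #|A|.
Proof.
move=> fP; pose B := [set x | (enum_rank x < enum_rank (f x))%N].
suff -> : #|A| = (#|A :&: B|).*2 by rewrite odd_double.
rewrite -(cardsID B A) -addnn; congr (_ + _)%N.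
rewrite -(@card_in_imset _ _ f (A :&: B)); last first.
  move=> x y /setIP[/fP[_ _ ffx] _] /setIP[/fP[_ _ ffy] _] fxy.
  by rewrite -ffx fxy ffy.
apply/eq_card => x; rewrite !inE; apply/idP/imsetP.
  case/andP=> xB /fP[fxA fxx ffx]; exists (f x) => //.
  rewrite !inE fxA ffx ltn_neqAle leqNgt xB andbT.
  by apply: contra fxx => /eqP/ord_inj/enum_rank_inj ->.
case=> y /setIP[/fP[fyA _ ffy]]; rewrite inE => yB ->.
by rewrite ffy fyA -leqNgt ltnW.
Qed.

(** Swapping and removing two elements of one fibre keeps the parity of every fibre; induct on
    [#|A|]. *)
Lemma fibrewise_involution A (k : T -> K) :
    (forall c, ~~ odd #|[set x in A | k x == c]|) ->
  exists f : T -> T,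
    {in A, forall x, [/\ f x \in A, f x != x, f (f x) = x & k (f x) = k x]}.
Proof.
elim: {A}_.+1 {-2}A (ltnSn #|A|) => // m IH A ltAm evA.
have [->|[x xA]] := set_0Vmem A; first by exists id => y; rewrite inE.
have [y] : exists y, y \in [set z in A | k z == k x] :\ x.
  apply/set0Pn; rewrite -cards_eq0; apply: contra (evA (k x)) => /eqP card0.
  by rewrite (cardsD1 x) card0 !inE xA eqxx.
rewrite !inE => /and3P[yx yA /eqP kyx].
have ltB : (#|A :\ x :\ y| < m)%N.
  by move: ltAm; rewrite (cardsD1 x) xA (cardsD1 y) !inE yx yA => /ltnW.
have [c|f fP] := IH (A :\ x :\ y) ltB.
  have := evA c; have [<-|kxc] := eqVneq (k x) c.
    rewrite (cardsD1 x) (cardsD1 y) !inE xA yA yx kyx !eqxx /= negbK.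
    by congr (~~ odd _); apply: eq_card => z; rewrite !inE !andbA.
  congr (~~ odd _); apply: eq_card => z; rewrite !inE.
  have [->|_] := eqVneq z y; first by rewrite kyx (negPf kxc) andbF.
  by have [->|_] := eqVneq z x; rewrite ?(negPf kxc) ?andbF.
exists (fun z => if z == x then y else if z == y then x else f z) => z zA.
have [->|zx] := eqVneq z x; first by rewrite (negPf yx) eqxx yA kyx.
have [->|zy] := eqVneq z y; first by rewrite eqxx eq_sym yx xA kyx.
have /fP[] : z \in A :\ x :\ y by rewrite !inE zx zy zA.
by rewrite !inE => /and3P[/negPf-> /negPf-> ->] ? ? ?.
Qed.

End FiniteMatchings.

(** * Cycles and separating vertices in a forest *)

Section Forests.
Variables (n : nat) (G : sgraph n).
Implicit Types (u v w x y : 'I_n) (r t : 'I_n -> 'I_n).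

Lemma connect_adjC : connect_sym G.
Proof. exact/sym_connect_sym/adj_sym. Qed.

Lemma adj_neq x y : G x y -> x != y.
Proof. by apply: contraTneq => ->; rewrite adj_irr. Qed.

Lemma componentsE : components G = [set [set y | connect G x y] | x : 'I_n].
Proof.
rewrite /components /equivalence_partition; apply/setP => C.
by apply/imsetP/imsetP=> -[x _ ->]; exists x => //; apply/setP => y; rewrite !inE.
Qed.

(* Isolates v rather than deleting it. *)
Definition avoiding v : rel 'I_n := [rel x y | [&& G x y, x != v & y != v]].

Lemma avoiding_sym v : connect_sym (avoiding v).
Proof.
by apply: sym_connect_sym => x y; rewrite /avoiding /= adj_sym; do 2!case: (_ != v).
Qed.

Lemma path_avoiding v x p :
  path G x p -> v \notin x :: p -> connect (avoiding v) x (last x p).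
Proof.
elim: p x => [|y p IH] x //=; rewrite !inE !negb_or => /andP[Gxy pp].
case/and3P=> vx vy vp; apply: connect_trans (IH y pp _); last first.
  by rewrite inE negb_or vy.
by apply: connect1; rewrite /avoiding /= Gxy !(eq_sym _ v) vx.
Qed.

Lemma avoiding_path v x p : path (avoiding v) x p -> path G x p && (v \notin p).
Proof.
elim: p x => //= y p IH x /andP[/and3P[-> _ yv] /IH/andP[-> vp]].
by rewrite inE negb_or eq_sym yv.
Qed.

Hypothesis forestG : is_forest G.

(** A cycle stays in the component of its first vertex, where the tree condition applies. *)
Lemma forest_acyclic c : ucycle G c -> (size c <= 2)%N.
Proof.
case: c => // x c /andP[cyc unq]; rewrite leqNgt; apply/negP => sz.
pose C := [set y | connect G x y].
have CG : C \in components G by rewrite componentsE; apply/imsetP; exists x.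
have [_ _ []] := forestG CG; exists (x :: c); split => //; rewrite /ucycle unq andbT.
move: (cyc); apply: (sub_in_cycle (P := [in C])).
  by move=> y z yC zC Gyz; apply/and3P; split; [exact: yC | exact: zC |].
apply/allP => y yc; rewrite /= !inE; move: yc; rewrite inE => /orP[/eqP->//|yc].
have /path_connect := cyc => /=; apply.
by rewrite inE mem_rcons inE yc !orbT.
Qed.

(** A simple path from [x] to [y] missing [v] would close up through [v] to a cycle. *)
Lemma forest_avoiding v x y :
  G v x -> G v y -> x != y -> ~~ connect (avoiding v) x y.
Proof.
move=> Gvx Gvy xy; apply/negP => /connectP[p0 /shortenP[p pp up _] yp].
have /andP[Gp vp] := avoiding_path pp.
have : ucycle G (v :: x :: p).
  rewrite /ucycle cons_uniq up inE negb_or adj_neq ?vp // /cycle /=.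
  by rewrite Gvx rcons_path Gp -yp adj_sym Gvy.
move/forest_acyclic; case: p {pp up Gp vp} yp => //= yx.
by rewrite yx eqxx in xy.
Qed.

End Forests.

(** * Rooted forests and the edge count *)

Section Edges.
Variables (n : nat) (G : sgraph n).
Implicit Types (u v w x y : 'I_n) (a : edge G).

Definition joins a u v := (val a == (u, v)) || (val a == (v, u)).

Lemma joinsC a u v : joins a u v = joins a v u.
Proof. exact: orbC. Qed.

Lemma joins_ends a : joins a (val a).1 (val a).2.
Proof. by rewrite /joins -surjective_pairing eqxx. Qed.

Lemma joins_adj a u v : joins a u v -> G u v.
Proof.
by case/orP=> /eqP e; case/andP: (valP a); rewrite e //= adj_sym.
Qed.

Lemma joins_inj a b u v : joins a u v -> joins b u v -> a = b.
Proof.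
move=> ja jb; apply: val_inj.
case/andP: (valP a) => + _; case/andP: (valP b) => + _.
case/orP: ja => /eqP ->; case/orP: jb => /eqP -> //= lt1.
  by rewrite ltnNge (ltnW lt1).
by rewrite ltnNge (ltnW lt1).
Qed.

Lemma joins_ends_eq a u v x y :
  joins a u v -> joins a x y -> (x = u /\ y = v) \/ (x = v /\ y = u).
Proof.
by case/orP=> /eqP e; rewrite /joins e => /orP[]/eqP[-> ->]; [left|right|right|left].
Qed.

Lemma adj_joins u v : G u v -> exists a, joins a u v.
Proof.
move=> Guv; have : u != v by apply: contraTneq Guv => ->; rewrite adj_irr.
rewrite neq_ltn => /orP[] ltuv.
  have aP : ((u, v).1 < (u, v).2)%N && G (u, v).1 (u, v).2 by rewrite ltuv.
  by exists (exist _ (u, v) aP); rewrite /joins eqxx.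
have aP : ((v, u).1 < (v, u).2)%N && G (v, u).1 (v, u).2 by rewrite ltuv adj_sym.
by exists (exist _ (v, u) aP); rewrite /joins eqxx orbT.
Qed.

End Edges.

Section RootedForest.
Variables (n : nat) (G : sgraph n) (forestG : is_forest G) (r : 'I_n -> 'I_n).
Hypothesis connect_root : forall v, connect G v (r v).
Hypothesis root_eq : forall u v, connect G u v -> r u = r v.
Implicit Types (u v w x y : 'I_n).

Lemma root_idem v : r (r v) = r v.
Proof. by rewrite -(root_eq (connect_root v)). Qed.

(** The next vertex after [v] on the way to the root. A root has no parent, since [avoiding G v]
    isolates [v]. *)
Definition parent u v := G u v && connect (avoiding G v) u (r v).

Lemma parent_adj u v : parent u v -> G u v.
Proof. by case/andP. Qed.

Lemma parent_root u v : parent u v -> r u = r v.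
Proof. by move/parent_adj/connect1/root_eq. Qed.

Lemma parent_inj u u' v : parent u v -> parent u' v -> u = u'.
Proof.
case/andP=> Guv cu /andP[Gu'v cu']; apply/eqP; apply/negP => /negP uu'.
have /negP[] := forest_avoiding (v := v) forestG (etrans (adj_sym _ _ _) Guv)
  (etrans (adj_sym _ _ _) Gu'v) uu'.
by apply: connect_trans cu _; rewrite avoiding_sym.
Qed.

Lemma parent_nonroot u v : parent u v -> r v != v.
Proof.
case/andP=> Guv /connectP[p /avoiding_path/andP[_ vp] rp].
have /eqP := adj_neq Guv; apply: contra_notN => /eqP rv.
by move: vp; rewrite rv in rp; case: p rp => //= x q ->; rewrite mem_last.
Qed.

Lemma path_to_root v : r v != v ->
  exists x q, [/\ G v x, path G x q, uniq (v :: x :: q) & last x q = r v].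
Proof.
move=> rv; have /connectP[p0 /shortenP[p pp up _] e] := connect_root v.
case: p pp up e => [_ _ e|x q /= /andP[Gvx pq] uq e]; last by exists x, q.
by rewrite e /= eqxx in rv.
Qed.

Lemma parent_exists v : r v != v -> exists u, parent u v.
Proof.
case/path_to_root=> x [q [Gvx pq /andP[vq _] e]]; exists x.
by rewrite /parent adj_sym Gvx -e path_avoiding.
Qed.

(** If [v] were also the parent of [u], the first step of a simple path from [u] to the root
    avoiding [v] would be a second parent of [u]; an empty path would make [u] a root with a
    parent. *)
Lemma parent_asym u v : parent u v -> ~~ parent v u.
Proof.
move=> puv; apply/negP => pvu; have [Guv cu] := andP puv.
case/connectP: cu => p0 /shortenP[p pp up _] e'.
case: p pp up e' => [_ _ /= ruv|y p /andP[/and3P[Guy _ yv] pp] /andP[up _] e'].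
  by have := parent_nonroot pvu; rewrite (parent_root puv) ruv eqxx.
case/negP: yv; apply/eqP; apply: parent_inj pvu.
rewrite /parent adj_sym Guy (parent_root puv) e' /=.
by case/andP: (avoiding_path pp) => pG _; apply: path_avoiding.
Qed.

(** A simple path from [v] to its root starts with the parent of [v]. If this is not [u], then [u]
    is not on the path, by [forest_avoiding], and the path shows that [v] is the parent of [u]. *)
Lemma parent_total u v : G u v -> parent u v || parent v u.
Proof.
move=> Guv; have ruv : r u = r v by apply/root_eq/connect1.
have [rv|] := eqVneq (r v) v.
  by rewrite /parent [G v u]adj_sym Guv ruv rv connect0 orbT.
case/path_to_root=> x [q [Gvx pq /andP[vq uq] e]].
have pxv : parent x v by rewrite /parent adj_sym Gvx -e path_avoiding.
have [<-|xu] := eqVneq x u; first by rewrite pxv.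
have [uinq|uq'] := boolP (u \in v :: x :: q).
  move: uinq; rewrite inE (negPf (adj_neq Guv)) => uinq.
  case/splitPl: uinq pq vq {uq e} => q1 q2 lq1.
  rewrite cat_path => /andP[pq1 _]; rewrite -cat_cons mem_cat => /norP[vq1 _].
  have /negP[] := forest_avoiding forestG Gvx (etrans (adj_sym _ _ _) Guv) xu.
  by rewrite -lq1 path_avoiding.
rewrite orbC {1}/parent [G v u]adj_sym Guv ruv -e.
by have -> : connect (avoiding G u) v (last x q) by
  apply: (@path_avoiding _ G u v (x :: q)); rewrite //= Gvx.
Qed.

Lemma card_roots : #|components G| = #|[set v | r v == v]|.
Proof.
pose K x := [set y | connect G x y].
have K_eq x y : connect G x y -> K x = K y.
  by move=> cxy; apply/setP => z; rewrite !inE (same_connect (connect_adjC G) cxy).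
rewrite -(@card_in_imset _ _ K); last first.
  move=> x y; rewrite !inE => /eqP rx /eqP ry /setP/(_ y).
  by rewrite !inE connect0 => /root_eq; rewrite rx ry.
congr #|pred_of_set _|; rewrite componentsE; apply/setP => C.
apply/imsetP/imsetP => -[x _ ->]; last by exists x.
by exists (r x); [rewrite inE root_idem | exact/K_eq/connect_root].
Qed.

(** Sending an edge to its child end is a bijection onto the vertices that are not roots. *)
Lemma card_forest : (#|{: edge G}| + #|components G| = n)%N.
Proof.
pose child (a : edge G) :=
  if parent (val a).1 (val a).2 then (val a).2 else (val a).1.
have childP a : exists2 u, parent u (child a) & joins a u (child a).
  rewrite /child; case: ifP => [p1|np1]; first by exists (val a).1; rewrite ?joins_ends.
  exists (val a).2; last by rewrite joinsC joins_ends.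
  by have /parent_total := joins_adj (joins_ends a); rewrite np1.
have child_inj : injective child.
  move=> a b eab; have [u pu ja] := childP a; have [u' pu' jb] := childP b.
  apply: joins_inj ja _; rewrite eab in pu *.
  by rewrite (parent_inj pu pu').
rewrite card_roots -[n in RHS]card_ord -(cardsC [set v | r v == v]) addnC.
congr (_ + _)%N; rewrite -(card_imset _ child_inj); apply: eq_card => v.
rewrite !inE; apply/imsetP/idP => [[a _ ->]|].
  by have [u /parent_nonroot] := childP a.
case/parent_exists=> u puv; have [a ja] := adj_joins (parent_adj puv).
exists a => //; have [u' pu' ja'] := childP a.
have [[_ ->]|[e1 e2]] := joins_ends_eq ja ja'; first by [].
by rewrite e1 e2 in pu'; have := parent_asym puv; rewrite pu'.
Qed.

End RootedForest.

(** * Cherries *)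

Section Cherries.
Variables (n : nat) (G : sgraph n) (t : 'I_n -> 'I_n).
Implicit Types (u v w x y : 'I_n).

Definition cherry u w := [&& G u w, G u (t w) & t w != w].

(** Given [t], a cherry through an edge is determined by which end is the centre, so the last two
    fields express existence and uniqueness. *)
Record cherry_involution : Prop := CherryInvolution {
  cherry_invK : involutive t;
  cherry_total : forall v w, G v w -> w != t v -> cherry v w || cherry w v;
  cherry_asym : forall v w, cherry v w -> ~~ cherry w v
}.

Lemma cherry_adj u w : cherry u w -> G u w.
Proof. by case/and3P. Qed.

Lemma cherryC u w : involutive t -> cherry u (t w) = cherry u w.
Proof. by move=> tK; rewrite /cherry tK eq_sym andbCA. Qed.

Hypothesis tP : cherry_involution.
Let tK := cherry_invK tP.

(** Substitute for the parent of [v] when no root is chosen. *)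
Definition uppers v := [set u | G u v && (cherry u v || (u == t v))].

Lemma upper_or_cherry v w : G v w -> (w \in uppers v) || cherry v w.
Proof.
move=> Gvw; rewrite inE adj_sym Gvw /=.
by have [->|/(cherry_total tP Gvw)] := eqVneq w (t v); rewrite ?orbT // orbF orbC.
Qed.

Hypothesis forestG : is_forest G.

(** Two centres [x], [y] over the leaf [v] would give the cycle [x], [v], [y], [t v]; a centre [x]
    and an edge from [v] to [t v] would give a triangle. *)
Lemma upper_uniq u u' v : u \in uppers v -> u' \in uppers v -> u = u'.
Proof.
suff cherry_only x y : x \in uppers v -> y \in uppers v -> cherry x v -> x = y.
  move=> uv u'v; have := uv; have := u'v; rewrite !inE.
  case/andP=> _ /orP[cu' _|/eqP e' /andP[_ /orP[cu|/eqP->//]]].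
    exact/esym/(cherry_only _ _ u'v uv).
  exact: cherry_only uv u'v cu.
rewrite !inE => _ /andP[Gyv cy] /and3P[Gxv Gxtv tvv]; apply/eqP.
case/orP: cy => [/and3P[_ Gytv _]|/eqP ytv].
  apply/negP => /negP xy.
  have /(forest_acyclic forestG) // : ucycle G [:: x; v; y; t v].
  rewrite /ucycle /= !inE !negb_or Gxv Gytv xy (eq_sym v (t v)) tvv.
  rewrite [G v y]adj_sym Gyv [G (t v) x]adj_sym Gxtv.
  by rewrite (adj_neq Gxv) (adj_neq Gxtv) (adj_neq Gytv) eq_sym (adj_neq Gyv).
have /(forest_acyclic forestG) // : ucycle G [:: x; v; t v].
rewrite -ytv in Gxtv tvv *; rewrite /ucycle /= !inE !negb_or Gxv [G v y]adj_sym Gyv.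
by rewrite [G y x]adj_sym Gxtv (adj_neq Gxv) (adj_neq Gxtv) eq_sym tvv.
Qed.

(** If [v] has an upper neighbour, its other neighbours are the leaves of cherries centred at [v],
    which [t] pairs off; so the degree is odd. *)
Lemma even_no_upper v : even_vertex G v -> uppers v = set0.
Proof.
apply: contraTeq => /set0Pn[u uv]; rewrite /even_vertex negbK /deg.
pose lowers := [set w | cherry v w].
have -> : [set w | G v w] = u |: lowers.
  apply/setP => w; rewrite !inE; apply/idP/orP.
    case/upper_or_cherry/orP=> [wv|]; last by right.
    by left; rewrite (upper_uniq wv uv).
  case=> [/eqP->|/cherry_adj//].
  by move: uv; rewrite inE adj_sym => /andP[].
rewrite cardsU1 [u \in lowers]inE.
have -> : ~~ cherry v u.
  move: uv; rewrite inE => /andP[_ /orP[/(cherry_asym tP)//|/eqP->]].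
  by rewrite /cherry tK adj_irr andbF.
rewrite /=; apply: (@involution_card_even _ _ t) => w; rewrite inE => cvw.
by rewrite inE cherryC // cvw tK; case/and3P: cvw.
Qed.

(* Without an upper neighbour among the vertices ahead, a simple path can only
   step from the centre of a cherry to one of its leaves. *)
Lemma simple_path_upper x p :
    path G x p -> uniq (x :: p) -> p != [::] ->
    (forall u, u \in uppers x -> u \notin p) ->
  exists u, u \in uppers (last x p).
Proof.
elim: p x => // w p IH x /= /andP[Gxw pp] /andP[xp up] _ xup.
have xw : x \in uppers w.
  rewrite inE Gxw; case/orP: (upper_or_cherry Gxw) => [/xup|->//].
  by rewrite inE eqxx.
have [->|p0] := eqVneq p [::]; first by exists x.
apply: IH => // u uw; rewrite (upper_uniq uw xw).
by apply: contra xp; rewrite inE orbC => ->.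
Qed.

(** On a simple path between distinct even vertices the first has no upper neighbour, so
    [simple_path_upper] gives one to the last, a contradiction. *)
Lemma cherry_component_even C : C \in components G ->
  (#|[set v in C | even_vertex G v]| <= 1)%N.
Proof.
rewrite componentsE => /imsetP[z _ ->]; apply/card_le1_eqP => x y.
rewrite !inE => /andP[zx ex] /andP[zy ey].
have /connectP[p0 /shortenP[p pp up _] e] : connect G x y.
  by apply: connect_trans zy; rewrite connect_adjC.
have [p0'|pn0] := eqVneq p [::]; first by rewrite e p0'.
have [u|u] := simple_path_upper pp up pn0.
  by rewrite even_no_upper // inE.
by rewrite -e even_no_upper // inE.
Qed.

End Cherries.

(** * A cherry involution from the condition on even vertices *)

Section RootedCherries.
Variables (n : nat) (G : sgraph n) (forestG : is_forest G).
Hypothesis component_even : forall C, C \in components G ->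
  (#|[set v in C | even_vertex G v]| <= 1)%N.
Implicit Types (u v w x y : 'I_n).

Let r v := odflt (fingraph.root G v) [pick u | connect G v u && even_vertex G u].

Let connect_r v : connect G v (r v).
Proof. by rewrite /r; case: pickP => [u /andP[]|_] //=; apply: fingraph.connect_root. Qed.

Let r_eq u v : connect G u v -> r u = r v.
Proof.
move=> cuv; rewrite /r (fingraph.rootP (connect_adjC G) cuv); congr odflt.
by apply: eq_pick => x; rewrite (same_connect (connect_adjC G) cuv).
Qed.

Let even_root v : even_vertex G v -> r v = v.
Proof.
move=> ev; rewrite /r; case: pickP => [u /andP[cvu eu]|/(_ v)] /=; last first.
  by rewrite connect0 ev.
have := @component_even [set y | connect G v y].
rewrite componentsE imset_f // => /(_ isT)/card_le1_eqP.
by apply; rewrite !inE ?cvu ?connect0.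
Qed.

Let par := parent G r.

Let degE u : deg G u = (#|[set w | par u w]| + (r u != u))%N.
Proof.
rewrite /deg; have [ru|/(parent_exists connect_r)[p pu]] /= := eqVneq (r u) u.
  rewrite addn0; apply: eq_card => w; rewrite !inE; apply/idP/idP.
    case/(parent_total forestG connect_r r_eq)/orP=> // /(parent_nonroot).
    by rewrite ru eqxx.
  exact: parent_adj.
have -> : [set w | G u w] = p |: [set w | par u w].
  apply/setP => w; rewrite !inE; apply/idP/orP.
    case/(parent_total forestG connect_r r_eq)/orP=> [|wu]; [by right | left].
    by rewrite (parent_inj forestG wu pu).
  by case=> [/eqP->|/parent_adj//]; rewrite adj_sym (parent_adj pu).
by rewrite cardsU1 inE (parent_asym forestG r_eq pu) addnC.
Qed.

(** The child grouped with [s] when [s] is a root of odd degree. *)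
Let special s : option 'I_n :=
  if odd (deg G s) && (r s == s) then [pick w | par s w] else None.

Let specialP s w : special s = Some w -> par s w.
Proof. by rewrite /special; case: ifP => // _; case: pickP => // x sx [<-]. Qed.

(* A vertex is either one of the two ends of the inner edge of an odd tree, and
   is grouped with the other end, or is grouped with its siblings. *)
Let group v : bool * 'I_n :=
  if (r v == v) || (special (r v) == Some v) then (true, r v)
  else (false, odflt v [pick u | par u v]).

Let group_true v s :
  group v = (true, s) -> r v = s /\ (v = s \/ special s = Some v).
Proof.
rewrite /group; case: ifP => // /orP[/eqP rv|/eqP sv] [<-]; split => //.
  by left.
by right.
Qed.

Let group_false v u : (group v == (false, u)) = par u v && (special u != Some v).
Proof.
rewrite /group; have [rv|rv] /= := eqVneq (r v) v.
  by apply/esym/negP => /andP[/parent_nonroot]; rewrite rv eqxx.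
have [sv|sv] /= := eqVneq (special (r v)) (Some v).
  apply/esym/negP => /andP[puv].
  by rewrite (parent_inj forestG puv (specialP sv)) sv eqxx.
rewrite xpair_eqE /=; case: pickP => [p pv|nop] /=; last first.
  by have [u' /negP[]] := parent_exists connect_r rv; rewrite -/par nop.
apply/eqP/andP => [<-|[puv _]]; last exact: parent_inj pv puv.
split=> //; apply: contra sv => /eqP spv; rewrite -(parent_root r_eq pv).
suff -> : r p = p by rewrite spv.
by move: spv; rewrite /special; case: ifP => // /andP[_ /eqP].
Qed.

(** The group [(true, s)] consists of [s] and its special child, or has no odd vertex. The group
    [(false, s)] consists of the other children of [s]; in [degE], one is subtracted for the parent
    of a nonroot or for the special child of an odd root. *)
Let group_even c : ~~ odd #|[set v in [set v | odd (deg G v)] | group v == c]|.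
Proof.
case: c => -[] s.
  have [/andP[os rs]|nrs] := boolP (odd (deg G s) && (r s == s)).
    have [w sw] : exists w, special s = Some w.
      rewrite /special os rs; case: pickP => [w _|no]; first by exists w.
      move: os; rewrite degE rs addn0; rewrite (_ : [set w | _] = set0) ?cards0 //.
      by apply/setP => w; rewrite !inE no.
    have psw := specialP sw; have rw : r w = s.
      by rewrite -(parent_root r_eq psw) (eqP rs).
    have ws : w != s by rewrite eq_sym; apply/adj_neq/(parent_adj psw).
    suff -> : [set v in [set v | odd (deg G v)] | group v == (true, s)] = [set w; s].
      by rewrite cards2 ws.
    apply/setP => v; rewrite !inE; apply/andP/orP.
      case=> _ /eqP/group_true[_ [->|]]; first by right.
      by rewrite sw => -[->]; left.
    case=> /eqP ->; last by rewrite os /group rs /= (eqP rs).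
    split; last by rewrite /group rw sw eqxx orbT.
    apply: contraTT (parent_nonroot psw) => ew; rewrite negbK.
    exact/eqP/even_root.
  rewrite (_ : [set v in _ | _] = set0) ?cards0 //; apply/setP => v; rewrite !inE.
  apply/negP => /andP[ov /eqP/group_true[rv [vs|sv]]]; last first.
    by move: sv; rewrite /special (negPf nrs).
  by move: nrs; rewrite -vs ov rv vs eqxx.
have nonroot_odd v : par s v -> odd (deg G v).
  move/parent_nonroot; apply: contraR => ev; exact/eqP/even_root.
have evch : ~~ odd (#|[set w | par s w]| - (special s != None)).
  have := degE s; rewrite /special.
  have [rs|rs] /= := eqVneq (r s) s.
    rewrite andbT addn0 => <-; case: ifP => [os|os]; last by rewrite eqxx subn0 os.
    case: pickP => [w _|no]; first by case: (deg G s) os => // d; rewrite subSS subn0.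
    move: os; rewrite degE rs eqxx addn0 (_ : [set w | _] = set0) ?cards0 //.
    by apply/setP => w; rewrite !inE no.
  rewrite andbF subn0 => dE; have : odd (deg G s).
    by apply: contraR rs => es; apply/eqP/even_root.
  by rewrite dE addn1.
move: evch; congr (~~ odd _).
have -> : [set v in [set v | odd (deg G v)] | group v == (false, s)]
    = [set w | par s w] :\: [set w | special s == Some w].
  apply/setP => w; rewrite !inE group_false andbA andbC; congr (_ && _).
  by apply/andP/idP => [[]//|psw]; split=> //; apply: nonroot_odd.
rewrite cardsD; congr (_ - _)%N; case sw: (special s) => [w|] /=.
  rewrite (_ : _ :&: _ = [set w]) ?cards1 //; apply/setP => v; rewrite !inE.
  apply/andP/eqP => [[_ /eqP[->//]]|->].
  by rewrite (specialP sw) eqxx.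
by rewrite (_ : _ :&: _ = set0) ?cards0 //; apply/setP => v; rewrite !inE andbF.
Qed.

(** [t] swaps odd vertices within their groups and fixes the even ones. *)
Lemma cherry_involution_exists : exists t, cherry_involution G t.
Proof.
have [s sP] := fibrewise_involution group_even.
pose t v := if odd (deg G v) then s v else v.
have tP v : odd (deg G v) -> [/\ odd (deg G (t v)), t v != v & group (t v) = group v].
  by move=> ov; have := sP v; rewrite /t ov !inE ov => /(_ isT)[].
have tK : involutive t.
  move=> v; have [ov|nov] := boolP (odd (deg G v)); last by rewrite /t !(negPf nov).
  by have := sP v; rewrite !inE /t ov => /(_ isT)[-> _ ->].
have odd_moved v : t v != v -> odd (deg G v).
  by rewrite /t; case: ifP => // _; rewrite eqxx.
have par_odd v w : par v w -> odd (deg G w).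
  by move/parent_nonroot; apply: contraR => ew; apply/eqP/even_root.
(* If [w] is an ordinary child of [v], then [t w] is a sibling. If it is the special child, its
   group has only [v] and [w], forcing [t w = v] against [w != t v]. *)
have par_cherry v w : par v w -> w != t v -> cherry G t v w.
  move=> pvw wtv; have [otw tww gw] := tP w (par_odd _ _ pvw).
  rewrite /cherry (parent_adj pvw) tww andbT.
  have [gwE|] := boolP (group w == (false, v)).
    by move: gwE; rewrite -gw group_false => /andP[/parent_adj->].
  rewrite group_false pvw negbK => /eqP svw.
  have rv : r v = v by move: svw; rewrite /special; case: ifP => // /andP[_ /eqP].
  have gwE : group w = (true, v).
    by rewrite /group -(parent_root r_eq pvw) rv svw eqxx orbT.
  have [_ [twv|]] := group_true (etrans gw gwE).
    by rewrite -twv tK eqxx in wtv.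
  by rewrite svw => -[e]; rewrite -e eqxx in tww.
(* A cherry with centre [w] and leaf [v] would make [t v] a child of [w] in the group of [v]. Then
   [v] is a child of its own child [w], or [w] is a root with a parent. *)
have no_both v w : par v w -> cherry G t v w -> ~~ cherry G t w v.
  move=> pvw _; apply/negP => /and3P[Gwv Gwtv tvv].
  have [otv _ gv] := tP v (odd_moved _ tvv).
  have : par w (t v).
    case/(parent_total forestG connect_r r_eq)/orP: Gwtv => // ptw.
    by rewrite -(parent_inj forestG pvw ptw) eqxx in tvv.
  move=> pwt; have [gE|] := boolP (group (t v) == (false, w)).
    move: gE; rewrite gv group_false => /andP[pwv _].
    by have := parent_asym forestG r_eq pvw; rewrite -/par pwv.
  rewrite group_false pwt negbK => /eqP sw.
  have rw : r w = w by move: sw; rewrite /special; case: ifP => // /andP[_ /eqP].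
  by have := parent_nonroot pvw; rewrite rw eqxx.
exists t; split => // v w.
  move=> Gvw wtv; case/(parent_total forestG connect_r r_eq)/orP: (Gvw) => p.
    by rewrite par_cherry.
  rewrite (par_cherry _ _ p) ?orbT //.
  by apply: contra wtv => /eqP->; rewrite tK.
move=> cvw; case/(parent_total forestG connect_r r_eq)/orP: (cherry_adj cvw) => p.
  exact: no_both.
by apply/negP => cwv; have := no_both _ _ p cwv; rewrite cvw.
Qed.

End RootedCherries.

Local Open Scope ring_scope.

(** * Brackets and adapted complex structures *)

Section LieLinearity.
Variables (R : pzRingType) (L : lieAlgType R).
Implicit Types (x y z : L) (a : R).

Lemma lie0l y : [lie 0, y] = 0 :> L.
Proof.
have := lie_linearl y 1 0 0; rewrite !scale1r addr0 => /eqP.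
by rewrite -subr_eq subrr => /eqP.
Qed.

Lemma lieDl x x' y : [lie x + x', y] = [lie x, y] + [lie x', y].
Proof. by have := lie_linearl y 1 x x'; rewrite !scale1r. Qed.

Lemma lieZl a x y : [lie a *: x, y] = a *: [lie x, y].
Proof. by have := lie_linearl y a x 0; rewrite lie0l !addr0. Qed.

Lemma lieNl x y : [lie - x, y] = - [lie x, y].
Proof. by rewrite -scaleN1r lieZl scaleN1r. Qed.

Lemma lieC x y : [lie x, y] = - [lie y, x].
Proof.
have rD z z' w : [lie w, z + z'] = [lie w, z] + [lie w, z'].
  by have := lie_linearr w 1 z z'; rewrite !scale1r.
by apply/eqP; rewrite -addr_eq0; have := liexx (x + y);
  rewrite lieDl !rD !liexx addr0 add0r => ->.
Qed.

Lemma lie0r x : [lie x, 0] = 0 :> L.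
Proof. by rewrite lieC lie0l oppr0. Qed.

Lemma lieDr x y y' : [lie x, y + y'] = [lie x, y] + [lie x, y'].
Proof. by have := lie_linearr x 1 y y'; rewrite !scale1r. Qed.

Lemma lieZr a x y : [lie x, a *: y] = a *: [lie x, y].
Proof. by have := lie_linearr x a y 0; rewrite lie0r !addr0. Qed.

End LieLinearity.

Section GraphLie.
Variables (R : realType) (n : nat) (G : sgraph n).
Local Notation bv := (@basis_vec R n G).
Implicit Types (u v w : 'I_n) (a : edge G) (b c : basis_index G).
Implicit Types (x y : graph_lie R G).

Lemma graph_lie_sum x : x = \sum_b x b *: bv b.
Proof.
apply/ffunP => c; rewrite sum_ffunE (bigD1 c) //= !ffunE eqxx [_ *: _]mulr1.
by rewrite big1 ?addr0 // => b /negPf cb; rewrite !ffunE eq_sym cb [_ *: _]mulr0.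
Qed.

Lemma signed_perm_coord (J : {linear graph_lie R G -> graph_lie R G}) p (s : _ -> bool) :
    injective p -> (forall b, J (bv b) = (-1) ^+ s b *: bv (p b)) ->
  forall x c, J x (p c) = (-1) ^+ s c * x c.
Proof.
move=> p_inj JE x c; rewrite [x in J x]graph_lie_sum linear_sum sum_ffunE.
rewrite (bigD1 c) //= linearZ JE /= !ffunE eqxx big1 => [|b /negPf bc].
  by rewrite addr0 /GRing.scale /= mulr1 mulrC.
by rewrite linearZ JE /= !ffunE (inj_eq p_inj) eq_sym bc; rewrite /GRing.scale /= !mulr0.
Qed.

Lemma lie_joins a u v : joins a u v ->
  [lie bv (inl u), bv (inl v)] = (-1) ^+ (v < u)%N *: bv (inr a).
Proof.
have lt_a : ((val a).1 < (val a).2)%N by case/andP: (valP a).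
case/orP=> /eqP e; move: lt_a (lie_edge R a); rewrite e /= => ltuv ea.
  by rewrite ea ltnNge (ltnW ltuv) scale1r.
by rewrite lieC ea ltuv scaleN1r.
Qed.

Definition joins_basis b b' c : bool :=
  match b, b', c with inl u, inl v, inr a => joins a u v | _, _, _ => false end.

Lemma lie_basis_neq0 b b' c : ([lie bv b, bv b'] c != 0) = joins_basis b b' c.
Proof.
case: b b' => [u|a] [v|a'] /=; try by rewrite lie_basis ffunE eqxx.
have [/adj_joins[a ja]|nG] := boolP (G u v); last first.
  rewrite lie_nonadj // ffunE eqxx; case: c => // a.
  by apply/esym; apply: contraNF nG; apply: joins_adj.
rewrite (lie_joins ja) !ffunE /GRing.scale /=.
have [->|ca] := eqVneq c (inr a); first by rewrite mulr1 signr_eq0 ja.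
rewrite mulr0 eqxx; case: c ca => // a' aa'; apply/esym.
by apply: contraNF aa' => ja'; rewrite (joins_inj ja ja').
Qed.

Lemma card_basis_index : #|{: basis_index G}| = (n + #|{: edge G}|)%N.
Proof. by rewrite card_sum card_ord. Qed.

(** [J (J b) = - b] has a nonzero coordinate at [b], which forces [p (p b) = b]; a fixed point of
    [p] would make the square of a sign equal to -1. *)
Lemma adapted_signed_perm (J : {linear graph_lie R G -> graph_lie R G}) :
    (forall x, J (J x) = - x) ->
    (forall b, exists c, J (bv b) = bv c \/ - J (bv b) = bv c) ->
  exists p (s : basis_index G -> bool),
    [/\ involutive p, forall b, p b != b
      & forall b, J (bv b) = (-1) ^+ s b *: bv (p b)].
Proof.
move=> JJ adJ.
have /fin_all_exists[f fP] b : exists cs : basis_index G * bool,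
    J (bv b) = (-1) ^+ cs.2 *: bv cs.1.
  have [c [Jc|Jc]] := adJ b; [exists (c, false) | exists (c, true)].
    by rewrite scale1r.
  by rewrite scaleN1r -Jc opprK.
have fK b : - bv b = (-1) ^+ (f b).2 * (-1) ^+ (f (f b).1).2 *: bv (f (f b).1).1.
  by rewrite -JJ fP linearZ /= fP scalerA.
have bb b : (- bv b) b = -1 by rewrite !ffunE eqxx.
exists (fst \o f), (snd \o f); split=> //= b.
  have := bb b; rewrite fK !ffunE; have [//|_] := eqVneq b.
  by move/eqP; rewrite [_ *: _]mulr0 eq_sym oppr_eq0 oner_eq0.
apply/negP => /eqP fb; have := bb b; rewrite fK !fb !ffunE eqxx -expr2 sqrr_sign.
rewrite [_ *: _]mulr1 => e; have := Num.Theory.gtrN (@Num.Theory.ltr01 R).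
by rewrite -e Order.POrderTheory.ltxx.
Qed.

End GraphLie.

(** * From an adapted complex structure to cherries *)

Section AdaptedToCherries.
Variables (R : realType) (n : nat) (G : sgraph n) (forestG : is_forest G).
Local Notation bv := (@basis_vec R n G).
Implicit Types (u v w : 'I_n) (a : edge G) (b c : basis_index G).

Lemma adapted_cherries : admits_adapted_complex_structure R G ->
  (exists t, cherry_involution G t) /\ ~~ odd (n + #|{: edge G}|).
Proof.
case=> J [[JJ Jint] /(adapted_signed_perm JJ)[p [s [pK pN JE]]]].
split; last first.
  rewrite -card_basis_index -cardsT; apply: (involution_card_even (f := p)) => b _.
  by rewrite in_setT pN pK.
have Jc x c : J x c = (-1) ^+ s (p c) * x (p c).
  by rewrite -(signed_perm_coord (can_inj pK) JE) pK.
pose br b b' c := [lie bv b, bv b'] c.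
have brE b b' c : (br b b' c == 0) = ~~ joins_basis b b' c.
  by rewrite -(lie_basis_neq0 R) negbK.
(* Integrability on two basis vectors, read at the coordinate [c]; [brE] decides which terms
   vanish. *)
have Nc b b' c : br b b' c +
    (-1) ^+ s (p c) * ((-1) ^+ s b * br (p b) b' (p c)
                       + (-1) ^+ s b' * br b (p b') (p c))
    - (-1) ^+ s b * ((-1) ^+ s b' * br (p b) (p b') c) = 0.
  have /ffunP/(_ c) := Jint (bv b) (bv b').
  rewrite 2!ffunE [(- _ : {ffun _}) c]ffunE [in X in _ + X - _]Jc [in X in _ * X]ffunE.
  by rewrite !JE !lieZl !lieZr !ffunE.
pose t v := if p (inl v) is inl w then w else v.
have ptE v : t v != v -> p (inl v) = inl (t v).
  by rewrite /t; case: (p (inl v)) => // a; rewrite eqxx.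
have tE v w : p (inl v) = inl w -> t v = w by rewrite /t => ->.
have tK : involutive t.
  move=> v; have [e|/ptE pv] := eqVneq (t v) v; first by rewrite !e.
  by apply: tE; rewrite -pv pK.
have tN v w : p (inl v) = inl w -> w != v.
  by move=> e; apply: contra (pN (inl v)) => /eqP wv; rewrite e wv.
exists t; split => // v w.
  move=> Gvw wtv; have [a ja] := adj_joins Gvw.
  (* At the edge [a] the first term of [Nc] is nonzero and the last is zero, since [w != t v]; so a
     middle term survives and exhibits the second edge of a cherry. *)
  have : (br (p (inl v)) (inl w) (p (inr a)) != 0)
      || (br (inl v) (p (inl w)) (p (inr a)) != 0).
    apply: contraT; rewrite negb_or !negbK => /andP[/eqP z1 /eqP z2].
    have := Nc (inl v) (inl w) (inr a); rewrite z1 z2 !mulr0 addr0 mulr0 addr0.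
    have -> : br (p (inl v)) (p (inl w)) (inr a) = 0.
      apply/eqP; rewrite brE; case ev: (p (inl v)) => [v'|//].
      case ew: (p (inl w)) => [w'|//] /=; apply/negP => ja'.
      case: (joins_ends_eq ja ja') => -[e1 e2].
        by have := tN _ _ ev; rewrite e1 eqxx.
      by rewrite (tE _ _ ev) e1 eqxx in wtv.
    by rewrite !mulr0 subr0 => /eqP; rewrite brE /= ja.
  rewrite !brE !negbK orbC => /orP[].
    case ew: (p (inl w)) => [w'|//]; case: (p (inr a)) => //= a' /joins_adj Gvw'.
    by rewrite /cherry Gvw (tE _ _ ew) Gvw' (tN _ _ ew).
  case ev: (p (inl v)) => [v'|//]; case: (p (inr a)) => //= a' /joins_adj Gv'w.
  by rewrite orbC /cherry adj_sym Gvw (tE _ _ ev) adj_sym Gv'w (tN _ _ ev).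
(* If both ends were centres, the injective [p] would send both the edge from [w] to [t v] and the
   edge from [v] to [t w] to the edge from [v] to [w]. *)
move=> /and3P[Gvw Gvtw tww]; apply/negP => /and3P[_ Gwtv tvv].
have nG : ~~ G (t v) (t w).
  apply/negP => Gtt.
  have /(forest_acyclic forestG) // : ucycle G [:: v; w; t v; t w].
  rewrite /ucycle /= !inE !negb_or Gvw Gwtv Gtt [G (t w) v]adj_sym Gvtw.
  rewrite (adj_neq Gvw) (adj_neq Gwtv) (adj_neq Gtt) (adj_neq Gvtw).
  by rewrite !(eq_sym _ (t _)) tvv tww.
(* At the coordinate [p (inr a)] the last term vanishes by [nG] and exactly one middle term is
   nonzero, so the first is nonzero too. *)
have p_joins a : joins a w (t v) (+) joins a v (t w) ->
    exists2 a', p (inr a) = inr a' & joins a' v w.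
  move=> ja; have : br (inl v) (inl w) (p (inr a)) != 0.
    apply/eqP => z; have := Nc (inl v) (inl w) (p (inr a)).
    rewrite z add0r !ptE // pK.
    have -> : br (inl (t v)) (inl (t w)) (p (inr a)) = 0.
      apply/eqP; rewrite brE; case: (p _) => //= a'.
      by apply: contra nG; apply: joins_adj.
    rewrite !mulr0 subr0 => /eqP; rewrite mulf_eq0 signr_eq0 /=.
    have := brE (inl (t v)) (inl w) (inr a); have := brE (inl v) (inl (t w)) (inr a).
    move: ja => /=; rewrite (joinsC a w); case: (joins a (t v) w) => /=.
      move/negPf=> -> /eqP-> /negPf z1; rewrite mulr0 addr0 mulf_eq0 signr_eq0 /=.
      by rewrite z1.
    by move=> -> /negPf z1 /eqP->; rewrite mulr0 add0r mulf_eq0 signr_eq0 /= z1.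
  by rewrite brE negbK; case: (p (inr a)) => //= a' ja'; exists a'.
have [a ja] := adj_joins Gwtv; have [a' ja'] := adj_joins Gvtw.
have jaN : ~~ joins a v (t w).
  apply/negP => j; case: (joins_ends_eq ja j) => -[e1 e2].
    by have := adj_neq Gvw; rewrite e1 eqxx.
  by rewrite -e1 eqxx in tvv.
have ja'N : ~~ joins a' w (t v).
  by apply: contra jaN => j; rewrite (joins_inj ja j).
have [|c pa jc] := p_joins a; first by rewrite ja (negPf jaN).
have [|c' pa' jc'] := p_joins a'; first by rewrite ja' (negPf ja'N).
have [aa'] : inr a = inr a' :> basis_index G.
  by apply: (can_inj pK); rewrite pa pa' (joins_inj jc jc').
by rewrite aa' ja' in jaN.
Qed.

End AdaptedToCherries.

(** * Formal properties of the integrability tensor *)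

Section Nijenhuis.
Variables (R : pzRingType) (L : lieAlgType R) (J : {linear L -> L}).
Hypothesis JJ : forall x, J (J x) = - x.
Implicit Types x y : L.

Definition nijenhuis x y :=
  [lie x, y] + J ([lie J x, y] + [lie x, J y]) - [lie J x, J y].

Lemma nijenhuisPl a x x' y :
  nijenhuis (a *: x + x') y = a *: nijenhuis x y + nijenhuis x' y.
Proof.
rewrite /nijenhuis !linearP /= !lieDl !lieZl addrACA -scalerDr linearP /=.
by rewrite scalerBr scalerDr opprD [X in X + _]addrACA [LHS]addrACA.
Qed.

Lemma nijenhuisC x y : nijenhuis x y = - nijenhuis y x.
Proof.
rewrite /nijenhuis (lieC y x) (lieC (J y) x) (lieC y) (lieC (J y)) -opprD linearN.
by rewrite /= !opprD !opprK [[lie x, J y] + _]addrC.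
Qed.

Lemma nijenhuis0l y : nijenhuis 0 y = 0.
Proof. by rewrite /nijenhuis linear0 !lie0l !(addr0, linear0, subr0). Qed.

Lemma nijenhuisxx x : nijenhuis x x = 0.
Proof. by rewrite /nijenhuis !liexx subr0 add0r [X in X + _]lieC addNr linear0. Qed.

(** Lets the vanishing pass between a basis vector and its image under [J]. *)
Lemma nijenhuisJ x y : nijenhuis (J x) y = - J (nijenhuis x y).
Proof.
rewrite /nijenhuis JJ !lieNl opprK linearD linearN linearB /= [J (_ + J _)]linearD /= JJ.
by rewrite !opprD !opprK [LHS]addrAC [RHS]addrAC addrC.
Qed.

(** The hypotheses turn [J [lie J x, y]] into [[lie J x, J y]] and [J [lie x, J y]] into [-
    [lie x, y]]. *)
Lemma nijenhuis_commuting x y :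
    (forall z, J [lie x, z] = [lie x, J z]) ->
    (forall z, J [lie J x, z] = [lie J x, J z]) ->
  nijenhuis x y = 0.
Proof.
move=> cx cJx; rewrite /nijenhuis linearD /= cJx -cx JJ.
by rewrite [_ - [lie x, y]]addrC addNKr subrr.
Qed.

End Nijenhuis.

Section SignedPermutation.
Variables (R : realType) (n : nat) (G : sgraph n).
Variables (p : basis_index G -> basis_index G) (s : basis_index G -> bool).
Local Notation bv := (@basis_vec R n G).

(** The sign sits at the target index: for an involution [p], the image of [b] carries the sign
    [s (p b)]. *)
Definition signed_perm (x : graph_lie R G) : graph_lie R G :=
  [ffun c => (-1) ^+ s c * x (p c)].

Lemma signed_perm_linear : linear signed_perm.
Proof.
by move=> a x y; apply/ffunP => c; rewrite !ffunE /GRing.scale /= mulrDr mulrCA.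
Qed.

HB.instance Definition _ := GRing.isLinear.Build R (graph_lie R G) (graph_lie R G)
  _ signed_perm signed_perm_linear.

Lemma signed_perm_basis b : involutive p ->
  signed_perm (bv b) = (-1) ^+ s (p b) *: bv (p b).
Proof.
move=> pK; apply/ffunP => c; rewrite !ffunE /GRing.scale /= -(inv_eq pK).
by have [<-|_] := eqVneq (p c) b; rewrite ?pK ?mulr0.
Qed.

End SignedPermutation.

(** * The signed matching of the basis defined by cherries *)

Section CherryMatching.
Variables (n : nat) (G : sgraph n) (t : 'I_n -> 'I_n).
Hypotheses (tP : cherry_involution G t) (evG : ~~ odd (n + #|{: edge G}|)).
Let tK := cherry_invK tP.
Implicit Types (u v w : 'I_n) (a : edge G) (b c : basis_index G).

(** Centre and leaf of the cherry through [a]; meaningful only if [a] is not [inner]. *)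
Let top a := if cherry G t (val a).1 (val a).2 then (val a).1 else (val a).2.
Let low a := if cherry G t (val a).1 (val a).2 then (val a).2 else (val a).1.
Let inner a := (val a).2 == t (val a).1.

Let top_low a : ~~ inner a -> cherry G t (top a) (low a) /\ joins a (top a) (low a).
Proof.
rewrite /inner /top /low => ia; case: ifP => [ca|nca].
  by rewrite joins_ends.
have := cherry_total tP (joins_adj (joins_ends a)) ia; rewrite nca => ca.
by rewrite joinsC joins_ends.
Qed.

Let cherry_inner a u w : cherry G t u w -> joins a u w -> ~~ inner a.
Proof.
case/and3P=> Guw Gutw tww ja; apply/negP => /eqP ia.
by case/orP: ja => /eqP e; rewrite e /= in ia; rewrite ia ?tK adj_irr in Gutw.
Qed.

Let top_low_eq a u w : cherry G t u w -> joins a u w -> top a = u /\ low a = w.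
Proof.
move=> cuw ja; have [c1 j1] := top_low (cherry_inner cuw ja).
have [[-> ->]//|[e1 e2]] := joins_ends_eq ja j1.
by move: c1 (cherry_asym tP cuw); rewrite e1 e2 => ->.
Qed.

Let other a := odflt a [pick a' | joins a' (top a) (t (low a))].

Let other_eq a a' u w :
  cherry G t u w -> joins a u w -> joins a' u (t w) -> other a = a'.
Proof.
move=> cuw ja ja'; rewrite /other; have [-> ->] := top_low_eq cuw ja.
by case: pickP => [a1 ja1|/(_ a')]; [exact: joins_inj ja1 ja' | rewrite ja'].
Qed.

Let leftover := [set b : basis_index G |
  match b with inl v => t v == v | inr a => inner a end].

Let paired b : basis_index G :=
  match b with inl v => inl (t v) | inr a => inr (other a) end.

Let pairedP b : b \notin leftover ->
  [/\ paired b \notin leftover, paired b != b & paired (paired b) = b].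
Proof.
rewrite inE; case: b => [v tv|a ia].
  by rewrite inE /= !tK eq_sym tv.
have [ca ja] := top_low ia; have [Gtl Gttl tl] := and3P ca.
have [a' ja'] := adj_joins Gttl.
have ca' : cherry G t (top a) (t (low a)) by rewrite cherryC.
rewrite /= (other_eq ca ja ja') inE (cherry_inner ca' ja').
rewrite (other_eq ca' ja' (a' := a)) ?tK //; split => //.
apply/eqP => -[aa']; rewrite aa' in ja'; case: (joins_ends_eq ja ja') => -[e1 e2].
  by rewrite e2 eqxx in tl.
by have := adj_neq Gtl; rewrite {1}e1 eqxx.
Qed.

Let leftover_even : ~~ odd #|leftover|.
Proof.
have : ~~ odd #|~: leftover|.
  apply: (involution_card_even (f := paired)) => b.
  by rewrite in_setC => /pairedP[]; rewrite in_setC.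
move: evG; rewrite -card_basis_index -(cardsC leftover) oddD.
by case: (odd _); case: (odd _).
Qed.

(** The condition [s (p b) = ~~ s b] makes [J] square to -1; the last sign formula makes [J [u, w] =
    [u, J w]] hold on cherries. *)
Lemma cherry_matching :
  exists (p : basis_index G -> basis_index G) (s : basis_index G -> bool),
  [/\ involutive p, forall b, s (p b) = ~~ s b,
      forall v, t v != v -> p (inl v) = inl (t v)
    & forall u w a a', cherry G t u w -> joins a u w -> joins a' u (t w) ->
        p (inr a) = inr a' /\
        s (inr a') = s (inl (t w)) (+) (w < u)%N (+) (t w < u)%N].
Proof.
(* A constant key leaves a single fibre, so the leftovers are matched arbitrarily. *)
have [c|rho rhoP] := @fibrewise_involution _ _ leftover (fun=> tt).
  by congr (~~ odd _): leftover_even; apply: eq_card => b; rewrite !inE andbT.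
pose p b := if b \in leftover then rho b else paired b.
have pL b : (p b \in leftover) = (b \in leftover).
  by rewrite /p; case: ifPn => [/rhoP[]|/pairedP[/negbTE]].
have pK : involutive p.
  move=> b; rewrite {1}/p pL /p; have [bL|bL] := boolP (b \in leftover).
    by case: (rhoP b bL) => _ _ ->.
  by case: (pairedP bL).
have pN b : p b != b.
  by rewrite /p; case: ifPn => [/rhoP[]//|/pairedP[]//].
pose s b : bool := if b \in leftover then (enum_rank b < enum_rank (p b))%N else
  match b with
  | inl v => (v < t v)%N
  (* chosen so that J [top a, low a] = [top a, J (low a)] for the oriented bracket *)
  | inr a => (low a < t (low a))%N (+) (t (low a) < top a)%N (+) (low a < top a)%N
  end.
have ltN (m : nat) (i j : 'I_m) : i != j -> (j < i)%N = ~~ (i < j)%N.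
  by move=> ij; rewrite -leqNgt [RHS]leq_eqVlt (inj_eq val_inj) eq_sym (negPf ij).
have pcherry u w a a' : cherry G t u w -> joins a u w -> joins a' u (t w) ->
    p (inr a) = inr a'.
  move=> cuw ja ja'; rewrite /p inE (negPf (cherry_inner cuw ja)).
  by rewrite /= (other_eq cuw ja ja').
exists p, s; split=> //.
- move=> b; rewrite /s pL; case: ifPn => bL.
    rewrite pK ltN // (inj_eq enum_rank_inj) eq_sym; exact: pN.
  rewrite {1}/p (negPf bL); move: bL; rewrite inE; case: b => [v|a] nL.
    by rewrite /= tK ltN // eq_sym.
  have [ca ja] := top_low nL; have [Gtl Gttl tl] := and3P ca.
  have [a' ja'] := adj_joins Gttl.
  have ca' : cherry G t (top a) (t (low a)) by rewrite cherryC.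
  rewrite /= (other_eq ca ja ja'); have [-> ->] := top_low_eq ca' ja'.
  (* Passing to the other edge negates the first comparison in [s] and exchanges the last two. *)
  by rewrite tK (ltN _ (low a)) 1?eq_sym // addbAC !addNb.
- by move=> v tv; rewrite /p inE (negPf tv).
move=> u w a a' cuw ja ja'; split; first exact: pcherry cuw ja ja'.
have ca' : cherry G t u (t w) by rewrite cherryC.
have [_ _ tww] := and3P cuw.
rewrite /s !inE (negPf (cherry_inner ca' ja')) tK eq_sym (negPf tww).
by have [-> ->] := top_low_eq ca' ja'; rewrite tK.
Qed.

End CherryMatching.

(** * From cherries to an adapted complex structure *)

Section CherriesToAdapted.
Variables (R : realType) (n : nat) (G : sgraph n) (forestG : is_forest G).
Variables (t : 'I_n -> 'I_n) (tP : cherry_involution G t).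
Let tK := cherry_invK tP.
Local Notation bv := (@basis_vec R n G).
Implicit Types (u v w : 'I_n) (a : edge G) (b c : basis_index G).

Lemma graph_lie_ind (P : graph_lie R G -> Prop) :
  P 0 -> (forall k b x, P x -> P (k *: bv b + x)) -> forall x, P x.
Proof.
by move=> P0 PD x; rewrite (graph_lie_sum x); apply: (big_rec P) => // b y _; apply: PD.
Qed.

Lemma cherries_adapted :
  ~~ odd (n + #|{: edge G}|) -> admits_adapted_complex_structure R G.
Proof.
case/(cherry_matching tP)=> p [s [pK sp pt pcherry]].
have [J JE JJ] : exists2 J : {linear graph_lie R G -> graph_lie R G},
    forall b, J (bv b) = (-1) ^+ s (p b) *: bv (p b) & forall x, J (J x) = - x.
  exists (signed_perm p s) => [b|x]; first exact: signed_perm_basis.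
  by apply/ffunP => c; rewrite !ffunE pK sp mulrA -signr_addb addbN addbb mulN1r.
exists J; split; last first.
  move=> b; exists (p b); rewrite JE; case: (s _); last by left; rewrite scale1r.
  by right; rewrite scaleN1r opprK.
have lie_edge0 a x : [lie bv (inr a), x] = 0.
  elim/graph_lie_ind: x => [|k b x IH]; first exact: lie0r.
  by rewrite lieDr IH lieZr lie_basis scaler0 addr0.
have lie_edge0r b a : [lie bv b, bv (inr a)] = 0 by rewrite lieC lie_edge0 oppr0.
have commute_cherry u w : cherry G t u w ->
    J [lie bv (inl u), bv (inl w)] = [lie bv (inl u), J (bv (inl w))].
  move=> cuw; have [Guw Gutw tww] := and3P cuw.
  have [a ja] := adj_joins Guw; have [a' ja'] := adj_joins Gutw.
  have [pa sa'] := pcherry _ _ _ _ cuw ja ja'.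
  have JwE := JE (inl w); have JaE := JE (inr a); rewrite ?pt ?pa // in JwE JaE.
  rewrite JwE lieZr (lie_joins R ja) (lie_joins R ja') linearZ /= JaE.
  rewrite !scalerA -!signr_addb sa'; congr ((-1) ^+ nat_of_bool _ *: _).
  by case: (s _); do 2!case: (_ < _)%N.
(* For these elements [J] commutes with the bracket, although a vertex fixed by [t] need not be
   central in the algebra. *)
pose central b := if b is inl v then t v == v else true.
have central_p b : central b -> central (p b).
  case pb: (p b) => [w|//] /=; have [//|tw] := eqVneq (t w) w.
  have := pt _ tw; rewrite -pb pK => ->; rewrite /= tK eq_sym.
  by rewrite (negPf tw).
(* A vertex fixed by [t] is a leaf of no cherry, so it is the centre on each of its edges. *)
have single_cherry v w : t v = v -> G v w -> cherry G t v w.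
  move=> tv Gvw; have := cherry_total tP Gvw; rewrite tv eq_sym (adj_neq Gvw) => /(_ isT).
  by case/orP=> // /and3P[_ _]; rewrite tv eqxx.
have central_commute b : central b ->
    forall x, J [lie bv b, x] = [lie bv b, J x].
  case: b => [v /eqP tv|a _] x; last by rewrite !lie_edge0 linear0.
  elim/graph_lie_ind: x => [|k c x IH]; first by rewrite linear0 !lie0r linear0.
  rewrite linearD linearZ /= !lieDr !lieZr linearD linearZ /= IH; congr (_ *: _ + _).
  case: c => [w|a].
    have [/(single_cherry v w tv)/commute_cherry//|nG] := boolP (G v w).
    rewrite lie_nonadj // linear0 JE lieZr; case pw: (p (inl w)) => [w'|a].
      have [Gvw'|nG'] := boolP (G v w'); last by rewrite lie_nonadj // scaler0.
      have /and3P[_ Gvtw' tw'] := single_cherry _ _ tv Gvw'.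
      have [e] : inl (t w') = inl w :> basis_index G by rewrite -pt // -pw pK.
      by rewrite e (negPf nG) in Gvtw'.
    by rewrite lie_edge0r scaler0.
  rewrite lie_edge0r linear0 JE lieZr; case pa: (p (inr a)) => [w'|a'].
    have [Gvw'|nG'] := boolP (G v w'); last by rewrite lie_nonadj // scaler0.
    have /and3P[_ _ tw'] := single_cherry _ _ tv Gvw'.
    by have := pt _ tw'; rewrite -pa pK.
  by rewrite lie_edge0r scaler0.
have nij_central b y : central b -> nijenhuis J (bv b) y = 0.
  move=> cb; apply: nijenhuis_commuting => // z; first exact: central_commute.
  by rewrite JE !lieZl linearZ /= central_commute // central_p.
(* An edge from [t u] to [w] or [t w] would create a 4-cycle or an opposite cherry. So brackets with
   [J u] vanish, and [[u, w] + J (J [u, w])] remains. *)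
have nij_cherry u w : t u != u -> cherry G t u w ->
    nijenhuis J (bv (inl u)) (bv (inl w)) = 0.
  move=> tuu cuw; have [Guw Gutw tww] := and3P cuw.
  have no_tu w' : cherry G t u w' -> ~~ G (t u) w'.
    move=> cuw'; have [Guw' Gutw' tww'] := and3P cuw'; apply/negP => Gtuw'.
    have wtu : w' != t (t u) by rewrite tK eq_sym (adj_neq Guw').
    case/orP: (cherry_total tP Gtuw' wtu) => [/and3P[_ Gtutw' _]|cw'].
      have /(forest_acyclic forestG) // : ucycle G [:: u; w'; t u; t w'].
      rewrite /ucycle /= !inE !negb_or Guw' [G w' _]adj_sym Gtuw' Gtutw'.
      rewrite [G _ u]adj_sym Gutw'.
      rewrite (adj_neq Guw') (adj_neq Gutw') (adj_neq Gtutw') !(eq_sym _ (t _)).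
      by rewrite tuu tww' (adj_neq Gtuw').
    by have := cherry_asym tP cuw'; rewrite -cherryC // cw'.
  have JuE := JE (inl u); have JwE := JE (inl w); rewrite !pt // in JuE JwE.
  have ctw : cherry G t u (t w) by rewrite cherryC.
  rewrite /nijenhuis -(commute_cherry _ _ cuw) JuE !lieZl (lie_nonadj R (no_tu _ cuw)).
  by rewrite JwE lieZr (lie_nonadj R (no_tu _ ctw)) !scaler0 add0r JJ subr0 subrr.
have nij_t u y : t u != u -> nijenhuis J (bv (inl (t u))) y = 0 ->
    nijenhuis J (bv (inl u)) y = 0.
  move=> tuu z; have := nijenhuisJ JJ (bv (inl u)) y; rewrite JE pt //.
  rewrite -[_ *: _]addr0 nijenhuisPl z nijenhuis0l scaler0 addr0 => /eqP.
  by rewrite eq_sym oppr_eq0 => /eqP e; apply: oppr_inj; rewrite -JJ e linear0 oppr0.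
have nij_tr u w : t w != w -> nijenhuis J (bv (inl u)) (bv (inl (t w))) = 0 ->
    nijenhuis J (bv (inl u)) (bv (inl w)) = 0.
  move=> tww z; rewrite nijenhuisC nij_t ?oppr0 //.
  by rewrite nijenhuisC z oppr0.
have nij_linked u w : t u != u -> t w != w -> w != u -> w != t u -> G u w ->
    nijenhuis J (bv (inl u)) (bv (inl w)) = 0.
  move=> tuu tww wu wtu Guw; case/orP: (cherry_total tP Guw wtu) => [|c].
    exact: nij_cherry.
  by rewrite nijenhuisC nij_cherry ?oppr0.
have nij_basis b c : nijenhuis J (bv b) (bv c) = 0.
  have [/nij_central//|cb] := boolP (central b).
  have [cc|cc] := boolP (central c); first by rewrite nijenhuisC nij_central ?oppr0.
  case: b c cb cc => [u|//] [w|//] /= tuu tww.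
  have ttu : t (t u) != t u by rewrite tK eq_sym.
  have ttw : t (t w) != t w by rewrite tK eq_sym.
  have [->|wu] := eqVneq w u; first exact: nijenhuisxx.
  have [->|wtu] := eqVneq w (t u); first by apply: nij_t => //; exact: nijenhuisxx.
  have twu : t w != u by apply: contra wtu => /eqP<-; rewrite tK.
  have twtu : t w != t u by rewrite (inj_eq (inv_inj tK)).
  (* [nij_t] and [nij_tr] replace a vertex by its partner, so any one edge between the two pairs
     reduces to [nij_linked]; without such an edge all brackets vanish. *)
  have [G1|G1] := boolP (G u w); first exact: nij_linked.
  have [G2|G2] := boolP (G (t u) w).
    by apply: nij_t => //; apply: nij_linked => //; rewrite tK.
  have [G3|G3] := boolP (G u (t w)).
    by apply: nij_tr => //; apply: nij_linked.
  have [G4|G4] := boolP (G (t u) (t w)).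
    by apply: nij_tr => //; apply: nij_t => //; apply: nij_linked => //; rewrite tK.
  rewrite /nijenhuis !JE !pt // !lieZl !lieZr !lie_nonadj // !scaler0.
  by rewrite addr0 linear0 subr0 addr0.
split=> // x y; rewrite -/(nijenhuis J x y).
elim/graph_lie_ind: x => [|k b x IH]; first exact: nijenhuis0l.
rewrite nijenhuisPl IH addr0; suff -> : nijenhuis J (bv b) y = 0 by rewrite scaler0.
elim/graph_lie_ind: y {IH} => [|k' c y IH]; first by rewrite nijenhuisC nijenhuis0l oppr0.
by rewrite nijenhuisC nijenhuisPl -[nijenhuis J y _]opprK -nijenhuisC IH
  [nijenhuis J (bv c) _]nijenhuisC nij_basis !oppr0 scaler0 addr0 oppr0.
Qed.

End CherriesToAdapted.

Theorem theorem7p1 (R : realType) (n : nat) (G : sgraph n)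
    (forestG : is_forest G) :
  admits_adapted_complex_structure R G <->
  ~~ odd #|components G| /\
  (forall C : {set 'I_n}, C \in components G ->
     (#|[set v in C | even_vertex G v]| <= 1)%N).
Proof.
(* By [card_forest], the left side counts every edge twice and every component once. *)
have parity : odd (n + #|{: edge G}|) = odd #|components G|.
  have rE u v : connect G u v -> fingraph.root G u = fingraph.root G v.
    exact: (fingraph.rootP (connect_adjC G)).
  rewrite -{1}(card_forest forestG (fingraph.connect_root G) rE).
  by rewrite addnAC addnn oddD odd_double.
split=> [/(adapted_cherries forestG)[[t tP] ev]|[ev evC]].
  by rewrite -parity; split=> // C; apply: cherry_component_even tP forestG C.
have [t tP] := cherry_involution_exists forestG evC.
by apply: (cherries_adapted R forestG tP); rewrite parity.
Qed.
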